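(* Let $N\ge1$, $h=1/N$, $\eta\ge0$, and consider the generalized matrix eigenvalue problem of $C^1$-quadratic softIGA with $N$ uniform elements on $[0,1]$, $$(\tilde K_2-\eta S_2)\hat U=\hat\lambda^h\tilde M_2\hat U,$$ with $\tilde K_2,\tilde M_2,S_2\in\mathbb R^{N\times N}$ as in the context. Its eigenpairs are $(\hat\lambda^h_j,\hat U_j)$, $j\in\{1,\dots,N\}$, where, with $t_j:=j\pi h$ and some normalization constants $c_j>0$, $$\hat\lambda^h_j=\frac{80\sin^2(\frac{t_j}2)}{h^2}\cdot\frac{2-18\eta+(1+24\eta)\cos(t_j)-6\eta\cos(2t_j)}{33+26\cos(t_j)+\cos(2t_j)},\qquad \hat U_j=c_j\big(\sin((k-\tfrac12)t_j)\big)_{k\in\{1,\dots,N\}}.$$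
   Context: $\tilde K_2,\tilde M_2,S_2$ are the matrices, in the B-spline basis of $C^1$ piecewise quadratics on the uniform mesh of $[0,1]$ vanishing at $0$ and $1$, of the bilinear forms $\int_0^1v'w'\,dx$, $\int_0^1 vw\,dx$, and $h^{3}\sum_{\text{interior nodes}}[\![v'']\!][\![w'']\!]+2h^3\big(v''(0)w''(0)+v''(1)w''(1)\big)$. Explicitly, they are symmetric and persymmetric $N\times N$ Toeplitz-plus-Hankel matrices $$A_{kl}=\sum_{m\in\mathbb Z}\big(a_{|k-l+2Nm|}-a_{|k+l-1+2Nm|}\big),\qquad 1\le k,l\le N,$$ with stencils (entries not listed are $0$): $\tilde K_2$: $(a_0,a_1,a_2)=\frac1h(1,-\frac13,-\frac16)$; $\tilde M_2$: $(a_0,a_1,a_2)=h(\frac{11}{20},\frac{13}{60},\frac1{120})$; $S_2$: $(a_0,a_1,a_2,a_3)=\frac1h(20,-15,6,-1)$. For instance, for large $N$ the first row of $S_2$ is $\frac1h(35,-21,7,-1,0,\dots)$ and the second is $\frac1h(-21,21,-15,6,-1,0,\dots)$. *)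

(* Defs.v *)
From HB Require Import structures.
From mathcomp Require Import all_boot all_order all_algebra.
From mathcomp Require Import all_classical all_reals all_analysis.

Set Implicit Arguments.
Unset Strict Implicit.
Unset Printing Implicit Defensive.

Import Order.TTheory GRing.Theory Num.Theory.

Local Open Scope classical_set_scope.
Local Open Scope ring_scope.

Section SoftIGA.
Variable R : realType.

(* A_kl = \sum_(m in Z) (a_|k-l+2Nm| - a_|k+l-1+2Nm|) for 1 <= k, l <= N.
   The ordinals k, l start at 0, hence the successors.  The sum is the
   finitely supported sum of fsbigop; for 0 < N and a stencil a with finite
   support, only finitely many of its terms are nonzero.  For N = 0 the
   matrix is empty. *)
Definition toeplitz_hankel (N : nat) (a : nat -> R) : 'M[R]_N :=
  \matrix_(k < N, l < N)
    \sum_(m \in [set: int])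
      (a (absz (k.+1%:Z - l.+1%:Z + (2 * N)%:Z * m))
       - a (absz (k.+1%:Z + l.+1%:Z - 1 + (2 * N)%:Z * m))).

Definition mesh (N : nat) : R := 1 / N%:R.

(* s`_i is 0 for i beyond the end of the list, as required of a stencil. *)
Definition stencil (c : R) (s : seq R) (i : nat) : R := c * s`_i.

(* C^1 quadratic B-splines vanishing at 0 and 1, N uniform elements:
   stiffness, mass and softness matrices, the last one being that of
     h^3 \sum_(interior nodes) [[v'']] [[w'']]
       + 2 h^3 (v''(0) w''(0) + v''(1) w''(1)). *)
Definition stiffness2 (N : nat) : 'M[R]_N :=
  toeplitz_hankel N (stencil (1 / mesh N) [:: 1; - (1 / 3); - (1 / 6)]).

Definition mass2 (N : nat) : 'M[R]_N :=
  toeplitz_hankel N (stencil (mesh N) [:: 11 / 20; 13 / 60; 1 / 120]).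

Definition softness2 (N : nat) : 'M[R]_N :=
  toeplitz_hankel N (stencil (1 / mesh N) [:: 20; - 15; 6; - 1]).

Definition gen_eigenpair (N : nat) (A B : 'M[R]_N) (lam : R) (U : 'cV[R]_N) :
  Prop := U != 0 /\ A *m U = lam *: (B *m U).

(* t_j = j pi h and the corresponding eigenvalue and (unnormalized)
   eigenvector; here j ranges over 1, ..., N. *)
Definition angle (N j : nat) : R := j%:R * pi * mesh N.

Definition soft_eigval (N : nat) (eta : R) (j : nat) : R :=
  let h := mesh N in let t := angle N j in
  (80 * sin (t / 2) ^+ 2) / h ^+ 2 *
  ((2 - 18 * eta + (1 + 24 * eta) * cos t - 6 * eta * cos (2 * t)) /
   (33 + 26 * cos t + cos (2 * t))).

(* The row index k : 'I_N starts at 0, hence k.+1. *)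
Definition soft_eigvec (N j : nat) : 'cV[R]_N :=
  \col_(k < N) sin (((k.+1)%:R - 1 / 2) * angle N j).

End SoftIGA.

(* Main.v *)
Require Import Defs.
From HB Require Import structures.
From mathcomp Require Import all_boot all_order all_algebra.
From mathcomp Require Import all_classical all_reals all_analysis.
From mathcomp Require Import ring lra zify.

Set Implicit Arguments.
Unset Strict Implicit.
Unset Printing Implicit Defensive.

Import Order.TTheory GRing.Theory Num.Theory.
Local Open Scope ring_scope.

(* Extend v_l = sin((l - 1/2) t_j) to all integers l.  The extension is odd
   under l -> 1 - l and 2N-periodic, so that folding the Toeplitz and Hankel
   sums turns the matrix of a stencil a into the convolution with a_|.| on Z,
   of which v is an eigenvector with eigenvalue a_0 + 2 sum_d a_d cos(d t_j).
   Hence all three matrices share the vectors v, and the eigenvalues of the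
   pencil are quotients of these symbols.  The vectors are independent because
   they belong to distinct eigenvalues 2 cos t_j of the stencil (0, 1); the mass
   symbol never vanishes, so in this basis the pencil is diagonal and its
   eigenvectors for mu are the combinations of the v with eigenvalue mu. *)

(** * Folding sums over residue classes of integers *)

(** A sum with infinite support is 0 by convention, so additivity rests on finite supports: all
    three sums are restricted to the union of the two supports. *)
Lemma fsbigD_finite_support (V : nmodType) (T : choiceType) (f g : T -> V) :
  finite_set (f @^-1` [set~ 0])%classic ->
  finite_set (g @^-1` [set~ 0])%classic ->
  \sum_(x \in [set: T]) (f x + g x) =
  \sum_(x \in [set: T]) f x + \sum_(x \in [set: T]) g x.
Proof.
move=> ff fg; set P := (f @^-1` [set~ 0] `|` g @^-1` [set~ 0])%classic.
have fP : finite_set P by rewrite finite_setU.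
have widen (h : T -> V) : (forall x, ~ P x -> h x = 0) ->
    \sum_(x \in [set: T]) h x = \sum_(x \in P) h x.
  by move=> h0; apply/esym/fsbig_widen => // x [_ /h0].
rewrite !widen ?fsbig_split //.
- by move=> x /not_orP[_ /contrapT].
- by move=> x /not_orP[/contrapT].
- by move=> x /not_orP[/contrapT -> /contrapT ->]; rewrite addr0.
Qed.

Section FoldingProgressions.
Variables (V : nmodType) (p : int) (r : seq int) (F : int -> V).
Hypotheses (p0 : p != 0) (ur : uniq r) (Fr : forall z, z \notin r -> F z = 0).

Lemma finite_support_progression (x : int) :
  finite_set ((fun m => F (x - p * m)) @^-1` [set~ 0])%classic.
Proof.
apply: (@sub_finite_set _ _ ((fun z => ((x - z) %/ p)%Z) @` [set` r])%classic).
  move=> m /= Fm; exists (x - p * m).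
    by apply: contrapT => /negP zr; apply: Fm; rewrite Fr.
  by rewrite opprB addrC subrK mulrC mulzK.
by apply: finite_image; apply: finite_seq.
Qed.

Lemma fsbig_progression (x : int) :
  \sum_(m \in [set: int]) F (x - p * m) =
  \sum_(z <- r | (z == x %[mod p])%Z) F z.
Proof.
rewrite [RHS]bigfs //; last by move=> z _; apply: Fr.
apply/esym/(reindex_fsbig (fun m => x - p * m)); split=> //.
- move=> m _ /=; rewrite unfold_in eqz_mod_dvd addrAC subrr add0r -mulrN.
  exact: dvdz_mulr.
- by move=> m n _ _ /addrI/oppr_inj/(mulfI p0).
- move=> z /=; rewrite unfold_in eqz_mod_dvd => /dvdzP[q zx].
  by exists (- q) => //; rewrite mulrN opprK mulrC -zx addrC subrK.
Qed.

End FoldingProgressions.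

(* Modulo 2N, the integers l and 1 - l, for 1 <= l <= N, form a complete
   residue system. *)
Lemma sum_reflected_residues (V : nmodType) (N : nat) (z : int) (x : V) :
  (0 < N)%N ->
  \sum_(l < N) ((if (z == l.+1%:Z %[mod (2 * N)%:Z])%Z then x else 0) +
                (if (z == 1 - l.+1%:Z %[mod (2 * N)%:Z])%Z then x else 0)) = x.
Proof.
move=> N0; have pN0 : (2 * N)%:Z != 0 by lia.
(* Write z - 1 = 2Nq + w with 0 <= w < 2N. With [l] counted from 0, the first congruence means w = l
   and the second w = 2N - 1 - l; so w < N selects one index of the first kind, w >= N one of the
   second. *)
have w0 := modz_ge0 (z - 1) pN0.
have wp := @ltz_pmod (z - 1) (2 * N)%:Z ltac:(lia).
have zw : z = 1 + ((z - 1) %/ (2 * N)%:Z)%Z * (2 * N)%:Z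
            + ((z - 1) %% (2 * N)%:Z)%Z.
  by rewrite -addrA -divz_eq; ring.
set w := (_ %% _)%Z in w0 wp zw.
set q := (_ %/ _)%Z in zw.
have dv (q' u : int) : - (2 * N)%:Z < u < (2 * N)%:Z ->
    ((2 * N)%:Z %| q' * (2 * N)%:Z + u)%Z = (u == 0).
  move=> up; apply/idP/eqP => [/dvdzP[s qs]|->]; last first.
    by rewrite addr0 dvdz_mull.
  have us : u = (s - q') * (2 * N)%:Z by rewrite mulrBl -qs; ring.
  have [sq|sq|sq] := ltrgtP (s - q') 0; last by rewrite us sq mul0r.
  - by nia.
  - by nia.
have E1 (l : 'I_N) : (z == l.+1%:Z %[mod (2 * N)%:Z])%Z = (w == l%:Z).
  have lN := ltn_ord l.
  rewrite eqz_mod_dvd -[RHS]subr_eq0 -(dv q); last by lia.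
  by congr (_ %| _)%Z; rewrite zw; lia.
have E2 (l : 'I_N) :
    (z == 1 - l.+1%:Z %[mod (2 * N)%:Z])%Z = (w == (2 * N)%:Z - l.+1%:Z).
  have lN := ltn_ord l.
  rewrite eqz_mod_dvd -[RHS]subr_eq0 -(dv (q + 1)); last by lia.
  by congr (_ %| _)%Z; rewrite zw; lia.
under eq_bigr => l _ do rewrite E1 E2.
have [n wn] : exists n : nat, w = n%:Z by exists (absz w); lia.
have [nN|Nn] := ltnP n N.
- rewrite (bigD1 (Ordinal nN)) //= big1 ?addr0 => [|l /eqP lw].
    by rewrite wn eqxx ifF ?addr0 //; lia.
  have lN := ltn_ord l; rewrite !ifF ?addr0 //; first by lia.
  by apply/eqP => wl; apply: lw; apply/val_inj => /=; lia.
- have n'N : (2 * N - n.+1 < N)%N by lia.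
  rewrite (bigD1 (Ordinal n'N)) //= big1 ?addr0 => [|l /eqP lw].
    by rewrite ifF ?ifT ?add0r //; lia.
  have lN := ltn_ord l; rewrite !ifF ?addr0 //; last by lia.
  by apply/eqP => wl; apply: lw; apply/val_inj => /=; lia.
Qed.

(** In column l, counted from 1, the Toeplitz terms are a_|k - z| with z = l - 2Nm, the Hankel terms
    those with z = 1 - l - 2Nm. Since v(1 - l) = - v(l), the minus sign of the latter is absorbed
    into v(z), and each integer z occurs exactly once. *)
Lemma toeplitz_hankel_mul (R : realType) (N : nat) (a : nat -> R)
    (r : seq int) (v : int -> R) (k : 'I_N) :
  uniq r -> (forall d : int, d \notin r -> a (absz d) = 0) ->
  (forall z, v (1 - z) = - v z) -> (forall z m, v (z - (2 * N)%:Z * m) = v z) ->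
  (toeplitz_hankel N a *m \col_(l < N) v l.+1%:Z) k 0 =
  \sum_(d <- r) a (absz d) * v (k.+1%:Z - d).
Proof.
move=> ur ar vN vp; have N0 : (0 < N)%N by apply: leq_trans (ltn_ord k).
have p0 : (2 * N)%:Z != 0 by lia.
pose F z := a (absz (k.+1%:Z - z)).
pose r' := [seq k.+1%:Z - d | d <- r].
have ur' : uniq r' by rewrite map_inj_uniq // => x y /addrI/oppr_inj.
have Fr' z : z \notin r' -> F z = 0.
  move=> zr; apply: ar; apply: contra zr => kzr.
  by apply/mapP; exists (k.+1%:Z - z) => //; ring.
transitivity (\sum_(z <- r') F z * v z); last first.
  by rewrite big_map; apply: eq_bigr => d _; rewrite /F opprB addrC subrK.
have Fvr z : z \notin r' -> F z * v z = 0 by move=> /Fr' ->; rewrite mul0r.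
transitivity (\sum_(l < N) (
    \sum_(z <- r' | (z == l.+1%:Z %[mod (2 * N)%:Z])%Z) F z * v z +
    \sum_(z <- r' | (z == 1 - l.+1%:Z %[mod (2 * N)%:Z])%Z) F z * v z)).
  rewrite mxE; apply: eq_bigr => l _; rewrite !mxE mulr_fsuml.
  rewrite -!(fsbig_progression _ ur' Fvr) //.
  rewrite -fsbigD_finite_support; try exact: finite_support_progression Fvr _.
  apply: eq_fsbigr => m _; rewrite /F !vp vN mulrBl mulrN.
  by congr (a (absz _) * _ - a (absz _) * _); ring.
under eq_bigr do rewrite big_mkcond [X in _ + X]big_mkcond -big_split.
rewrite exchange_big; apply: eq_bigr => z _.
exact: sum_reflected_residues.
Qed.

(* Only for stencils of at most four entries. *)
Definition stencil_symbol (R : realType) (c : R) (s : seq R) (t : R) : R :=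
  c * (s`_0 + 2 * (s`_1 * cos t + s`_2 * cos (2 * t) + s`_3 * cos (3 * t))).

Lemma sinBz2pi (R : realType) (x : R) (n : int) :
  sin (x - n%:~R * (2 * pi)) = sin x.
Proof.
have per := periodicn (@sinD2pi R); case: n => n.
  rewrite -[LHS](per n); congr sin.
  by rewrite -[pi *+ 2 *+ n]mulr_natl -mulr_natl; ring.
rewrite -[RHS](per n.+1); congr sin.
by rewrite NegzE mulrNz -[pi *+ 2 *+ _]mulr_natl -mulr_natl /=; ring.
Qed.

(** * Sine vectors as common eigenvectors of all stencils *)

Section DiscreteSines.
Variables (R : realType) (N : nat).
Hypothesis N0 : (0 < N)%N.

Lemma toeplitz_hankel_eigvec (c : R) (s : seq R) (j : nat) :
  (size s <= 4)%N ->
  toeplitz_hankel N (stencil c s) *m soft_eigvec R N j =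
  stencil_symbol c s (angle R N j) *: soft_eigvec R N j.
Proof.
move=> s4; set t := angle R N j.
pose v (z : int) : R := sin ((z%:~R - 1 / 2) * t).
have vN z : v (1 - z) = - v z.
  by rewrite /v -sinN; congr sin; rewrite intrB; field.
(* As N t = j pi, a shift by 2Nm changes the argument by m j full turns. *)
have vp z m : v (z - (2 * N)%:Z * m) = v z.
  rewrite /v -[RHS](sinBz2pi _ (m * j%:Z)); congr sin.
  have NR : N%:R != 0 :> R by rewrite pnatr_eq0 -lt0n.
  rewrite /t /angle /mesh intrB !intrM PoszM intrM /=; field.
  exact: NR.
have -> : soft_eigvec R N j = \col_(l < N) v l.+1%:Z by [].
pose r : seq int := [:: 0%:Z; 1%:Z; - 1%:Z; 2%:Z; - 2%:Z; 3%:Z; - 3%:Z].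
have sr (d : int) : d \notin r -> stencil c s (absz d) = 0.
  rewrite !inE => dr; rewrite /stencil nth_default ?mulr0 //.
  by apply: (leq_trans s4); lia.
apply/colP => k; rewrite (@toeplitz_hankel_mul _ _ _ r) // !mxE.
rewrite !big_cons big_nil /stencil /stencil_symbol /v.
(* The terms in sin (d t) are odd in d and cancel between d and -d; the cosine terms add up to the
   symbol. *)
have sE (d : int) : sin (((k.+1%:Z - d)%:~R - 1 / 2) * t) =
    sin ((k.+1%:R - 1 / 2) * t) * cos (d%:~R * t) -
    cos ((k.+1%:R - 1 / 2) * t) * sin (d%:~R * t).
  by rewrite -sinB; congr sin; rewrite intrB; ring.
rewrite !sE !abszN !absz_nat !mulrNz -!pmulrn !mulNr !cosN !sinN.
by rewrite mul0r cos0 sin0 !mul1r; ring.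
Qed.

Lemma mesh_gt0 : 0 < mesh R N.
Proof. by rewrite divr_gt0 ?ltr0n. Qed.

Lemma angle_gt0 (j : 'I_N) : 0 < angle R N j.+1.
Proof. by rewrite /angle !mulr_gt0 ?pi_gt0 ?invr_gt0 ?ltr0n. Qed.

Lemma angle_le_pi (j : 'I_N) : angle R N j.+1 <= pi.
Proof.
rewrite /angle /mesh mul1r mulrAC ler_piMl ?pi_ge0 //.
by rewrite ler_pdivrMr ?ltr0n // mul1r ler_nat.
Qed.

Lemma cos_angle_inj : injective (fun j : 'I_N => cos (angle R N j.+1)).
Proof.
have mesh0 : mesh R N != 0 by rewrite gt_eqF ?mesh_gt0.
have pi0 : pi != 0 :> R by rewrite gt_eqF ?pi_gt0.
move=> i j /cos_inj; rewrite !in_itv /= !angle_le_pi !ltW ?angle_gt0 //.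
move=> /(_ isT isT) /(mulIf mesh0) /(mulIf pi0) /eqP.
by rewrite eqr_nat eqSS => /eqP /val_inj.
Qed.

Lemma soft_eigvec_neq0 (j : 'I_N) : soft_eigvec R N j.+1 != 0.
Proof.
(* The first entry is sin (t / 2), with 0 < t / 2 <= pi / 2. *)
apply/eqP => /colP/(_ (Ordinal N0)); rewrite !mxE /= => /eqP; apply/negP.
rewrite gt_eqF // sin_gt0_pi //.
have t0 := angle_gt0 j; have tp := angle_le_pi j; have p0 := pi_gt0 R.
by apply/andP; split; lra.
Qed.

End DiscreteSines.

(** * Independent eigenvectors and simultaneously diagonal pencils *)

Lemma eigenvectors_independent (F : fieldType) (n m : nat) (T : 'M[F]_n)
    (lam : 'I_m -> F) (U : 'I_m -> 'cV[F]_n) (x : 'I_m -> F) :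
  injective lam -> (forall j, U j != 0) ->
  (forall j, T *m U j = lam j *: U j) ->
  \sum_(j < m) x j *: U j = 0 -> forall j, x j = 0.
Proof.
move=> lam_inj U0 TU sum0 j.
(* Applying the product of the T - lam i, for i in s, to the relation. *)
have prod0 (s : seq 'I_m) :
    \sum_(k < m) (x k * \prod_(i <- s) (lam k - lam i)) *: U k = 0.
  elim: s => [|i s IHs].
    by under eq_bigr do rewrite big_nil mulr1.
  set S := \sum_(k < m) _ in IHs.
  transitivity (T *m S - lam i *: S).
    rewrite /S mulmx_sumr scaler_sumr -sumrB; apply: eq_bigr => k _.
    rewrite big_cons -scalemxAr TU !scalerA -scalerBl; congr (_ *: _).
    by ring.
  by rewrite IHs mulmx0 scaler0 subr0.
(* All indices but [j]: only the [j]-th term survives, its coefficient being [x j] times nonzero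
   differences. *)
have := prod0 [seq i <- index_enum 'I_m | i != j].
rewrite (bigD1 j) //= [X in _ + X]big1 ?addr0 => [|k kj].
  move/eqP; rewrite scaler_eq0 (negPf (U0 j)) orbF mulf_eq0.
  case/orP => [/eqP //|]; rewrite big_filter prodf_seq_eq0 => /hasP[i _].
  by case/andP => ij; rewrite subr_eq0 => /eqP/lam_inj ji; rewrite ji eqxx in ij.
rewrite (bigD1_seq k) ?mem_filter ?kj ?mem_index_enum //=; last first.
  by rewrite filter_uniq ?index_enum_uniq.
by rewrite subrr mul0r mulr0 scale0r.
Qed.

Lemma gen_eigenpair_basisP (F : realType) (n : nat) (A B : 'M[F]_n)
    (alpha beta lam : 'I_n -> F) (U : 'I_n -> 'cV[F]_n) (mu : F)
    (V : 'cV[F]_n) :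
  basis_of {: 'cV[F]_n} [tuple U j | j < n] ->
  (forall j : 'I_n, A *m U j = alpha j *: U j) ->
  (forall j : 'I_n, B *m U j = beta j *: U j) ->
  (forall j, beta j != 0) -> (forall j, alpha j = lam j * beta j) ->
  gen_eigenpair A B mu V <->
  V != 0 /\ exists x : 'I_n -> F, V = \sum_(j < n | lam j == mu) x j *: U j.
Proof.
set W := [tuple U j | j < n] => bW AU BU b0 ab.
have WE (j : 'I_n) : W`_j = U j by rewrite -tnth_nth tnth_mktuple.
split=> -[V0].
- move=> AV; split=> //; exists (fun j => coord W j V).
  have VU : V = \sum_(j < n) coord W j V *: U j.
    by under eq_bigr do rewrite -WE; apply: coord_basis bW (memvf V).
  rewrite [LHS]VU [RHS]big_mkcond; apply: eq_bigr => j _.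
  case: ifPn => // lj; move: j lj.
  (* These are the coordinates of A V - mu B V, so each vanishes; as [beta j] is nonzero, V has no
     component with [lam j] different from [mu]. *)
  have /freeP/(_ (fun j => coord W j V * (lam j - mu) * beta j)) := basis_free bW.
  under eq_bigr do rewrite WE.
  have -> : \sum_(i < n) (coord W i V * (lam i - mu) * beta i) *: U i =
     A *m V - mu *: (B *m V).
    rewrite {2 3}VU !mulmx_sumr scaler_sumr -sumrB; apply: eq_bigr => i _.
    rewrite -!scalemxAr AU BU !scalerA -scalerBl ab; congr (_ *: _).
    by ring.
  rewrite AV subrr => /(_ erefl) H j lj; have /eqP := H j.
  rewrite !mulf_eq0 (negPf (b0 j)) orbF subr_eq0 (negPf lj) orbF => /eqP ->.
  by rewrite scale0r.
- case=> x Vx; split=> //; rewrite Vx !mulmx_sumr scaler_sumr.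
  apply: eq_bigr => j /eqP lj.
  rewrite -!scalemxAr AU BU !scalerA ab lj; congr (_ *: _).
  by ring.
Qed.

(** * The softIGA pencil: eigenbasis and symbols *)

Section SoftIGAEigenvalues.
Variables (R : realType) (N : nat).
Hypothesis N0 : (0 < N)%N.

(** The eigenvalues of the pencil can coincide for some eta, so independence is taken from an
    auxiliary stencil with simple spectrum; N free vectors then span by dimension. *)
Lemma soft_eigvec_basis (c : 'I_N -> R) :
  (forall j, c j != 0) ->
  basis_of {: 'cV[R]_N} [tuple c j *: soft_eigvec R N j.+1 | j < N].
Proof.
move=> c0; rewrite basisEfree subvf size_tuple dimvf.
have -> : dim 'cV[R]_N = N by rewrite dim_matrix mulr1.
rewrite leqnn !andbT; apply/freeP => x xU.
pose lam (j : 'I_N) : R := 2 * cos (angle R N j.+1).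
apply: (@eigenvectors_independent _ _ _
  (toeplitz_hankel N (stencil 1 [:: 0; 1])) lam
  (fun j => c j *: soft_eigvec R N j.+1)).
- move=> i j /mulfI; rewrite pnatr_eq0 => /(_ isT).
  exact: (cos_angle_inj N0).
- by move=> j; rewrite scaler_eq0 negb_or c0 soft_eigvec_neq0.
- move=> j; rewrite -scalemxAr toeplitz_hankel_eigvec // !scalerA.
  by congr (_ *: _); rewrite /stencil_symbol /lam /=; ring.
- rewrite -[RHS]xU; apply: eq_bigr => j _.
  by rewrite -tnth_nth tnth_mktuple.
Qed.

Definition mass2_eigval (j : nat) : R :=
  stencil_symbol (mesh R N) [:: 11 / 20; 13 / 60; 1 / 120] (angle R N j).

Definition soft_stiffness2_eigval (eta : R) (j : nat) : R :=
  stencil_symbol (1 / mesh R N) [:: 1; - (1 / 3); - (1 / 6)] (angle R N j)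
  - eta * stencil_symbol (1 / mesh R N) [:: 20; - 15; 6; - 1] (angle R N j).

Lemma cos2x (x : R) : cos (2 * x) = 2 * cos x ^+ 2 - 1.
Proof. by rewrite mulr_natl cos_mulr2n -mulr_natl. Qed.

Lemma cos3x (x : R) : cos (3 * x) = 4 * cos x ^+ 3 - 3 * cos x.
Proof.
have -> : 3 * x = 2 * x + x by ring.
rewrite cosD cos2x [2 * x]mulr_natl mulr2n sinD.
by have := sin2cos2 x; rewrite expr2 => ss; ring: ss.
Qed.

(** With y = cos x this is 2y^2 + 26y + 32, which is increasing for y >= -1 and equals 8 at y =
    -1. *)
Lemma mass_symbol_gt0 (x : R) : 0 < 33 + 26 * cos x + cos (2 * x).
Proof. by rewrite cos2x; have := cos_geN1 x; nra. Qed.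

Lemma mass2_eigvalE j : mass2_eigval j =
  mesh R N / 60 * (33 + 26 * cos (angle R N j) + cos (2 * angle R N j)).
Proof. by rewrite /mass2_eigval /stencil_symbol /=; field. Qed.

Lemma mass2_eigval_neq0 j : mass2_eigval j != 0.
Proof.
rewrite mass2_eigvalE gt_eqF // mulr_gt0 ?mass_symbol_gt0 //.
by rewrite divr_gt0 ?mesh_gt0 ?ltr0n.
Qed.

(** With x = cos t, the stiffness symbol is 2(1 - x)(2 + x)/(3h) and the softness symbol 8(1 -
    x)^3/h. Their common factor 1 - x = 2 sin^2(t/2) is the one in front of [soft_eigval]. *)
Lemma soft_stiffness2_eigvalE eta j :
  soft_stiffness2_eigval eta j = soft_eigval N eta j * mass2_eigval j.
Proof.
rewrite mass2_eigvalE /soft_eigval /soft_stiffness2_eigval /stencil_symbol /=.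
set t := angle R N j; have D0 := mass_symbol_gt0 t.
have s2 : sin (t / 2) ^+ 2 = (1 - cos t) / 2.
  have -> : cos t = cos (2 * (t / 2)) by congr cos; field.
  by rewrite cos2x sin2cos2; field.
rewrite s2; move: D0; rewrite cos3x cos2x; set x := cos t => D0.
have h0 := mesh_gt0 R N0; field.
by rewrite !gt_eqF.
Qed.

End SoftIGAEigenvalues.

Theorem lemma3 (R : realType) (N : nat) (hN : (1 <= N)%N) (eta : R)
    (heta : 0 <= eta) (c : 'I_N -> R) (hc : forall j : 'I_N, 0 < c j) :
  let A : 'M[R]_N := stiffness2 R N - eta *: softness2 R N in
  let B : 'M[R]_N := mass2 R N in
  let lam (j : 'I_N) : R := soft_eigval N eta j.+1 in
  let U (j : 'I_N) : 'cV[R]_N := c j *: soft_eigvec R N j.+1 in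
  (forall j : 'I_N, gen_eigenpair A B (lam j) (U j)) /\
  basis_of {: 'cV[R]_N} [seq U j | j : 'I_N] /\
  (forall (mu : R) (V : 'cV[R]_N),
     gen_eigenpair A B mu V <->
     V != 0 /\ exists x : 'I_N -> R, V = \sum_(j < N | lam j == mu) x j *: U j).
Proof.
move=> A B lam U.
have c0 j : c j != 0 by rewrite gt_eqF.
have AU j : A *m U j = soft_stiffness2_eigval N eta j.+1 *: U j.
  rewrite /U -scalemxAr mulmxBl -scalemxAl !toeplitz_hankel_eigvec //.
  by rewrite !scalerA -scalerBl !scalerA; congr (_ *: _); rewrite mulrC.
have BU j : B *m U j = mass2_eigval R N j.+1 *: U j.
  by rewrite /U -scalemxAr toeplitz_hankel_eigvec // !scalerA mulrC.
have bU := soft_eigvec_basis hN c0.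
split=> [j|]; last split=> [|mu V].
- split; first by rewrite scaler_eq0 negb_or c0 soft_eigvec_neq0.
  by rewrite AU BU scalerA soft_stiffness2_eigvalE.
- exact: bU.
- apply: (gen_eigenpair_basisP mu V bU AU BU) => j.
  + exact: mass2_eigval_neq0.
  + exact: soft_stiffness2_eigvalE.
Qed.
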